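(* Let $a=(\Sigma,\vdash)$ and $a'=(\Sigma',\vdash')$ be Lindenbaum algebraizable logics and let $\mathbb{G}=(h:a\to a',\bar\rho)$ be a Glivenko's context, with lifting $\rho_X:F(\Sigma')(X)\to F(\Sigma)(X)$ of $\bar\rho_X$. Then for every $\Gamma'\cup\{\varphi'\}\subseteq F(\Sigma')(X)$, $$\rho_X[\Gamma']\vdash\rho_X(\varphi')\iff\Gamma'\vdash'\varphi'.$$
   Context: **Logics.** A signature is a sequence $\Sigma=(\Sigma_n)_{n\in\mathbb{N}}$ of pairwise disjoint sets ($\Sigma_n$: the $n$-ary connectives). $X=\{x_0,x_1,\dots\}$ is a fixed countable set of variables, $F(\Sigma)=F(\Sigma)(X)$ is the absolutely free $\Sigma$-algebra (set of formulas) on $X$, and $F(\Sigma)[n]$ is the set of formulas whose variables are exactly $x_0,\dots,x_{n-1}$. A logic is a pair $a=(\Sigma,\vdash)$ with $\vdash\subseteq\mathcal P(F(\Sigma))\times F(\Sigma)$ a reflexive, monotone, finitary, structural (substitution-invariant) relation satisfying cut. A flexible morphism $f:\Sigma\to\Sigma'$ is a family of functions $\Sigma_n\to F(\Sigma')[n]$; it extends to $\check f:F(\Sigma)\to F(\Sigma')$ by $\check f(x)=x$ for $x\in X$ and $\check f(c_n(\psi_0,\dots,\psi_{n-1}))=f(c_n)[x_0|\check f(\psi_0),\dots,x_{n-1}|\check f(\psi_{n-1})]$. A flexible translation $f:(\Sigma,\vdash)\to(\Sigma',\vdash')$ is a flexible morphism such that $\Gamma\vdash\psi$ implies $\check f[\Gamma]\vdash'\check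 f(\psi)$. **Algebraizable logics** (Blok–Pigozzi). For a class $K$ of $\Sigma$-algebras, $\models_K$ is the equational consequence of $K$. A logic $a=(\Sigma,\vdash)$ is algebraizable if there are a class $K$, a finite set $\tau(p)=\{(\varepsilon^j(p),\delta^j(p))\}_{j}$ of equations in one variable and a finite set $\Delta(p,q)$ of formulas in two variables such that $\Gamma\vdash\varphi$ iff $\bigcup_{\gamma\in\Gamma}\tau(\gamma)\models_K\tau(\varphi)$, and $\varphi\equiv\psi$ is interderivable under $\models_K$ with $\tau(\varphi\Delta\psi)$. Then $(\tau,\Delta)$ is an algebraizing pair, and there is a unique quasivariety $QV(a)$ that can serve as $K$. $\varphi/\Delta=[\varphi]=\{\psi:\ \vdash\varphi\Delta\psi\}$ (independent of the choice of $\Delta$); $F(\Sigma)/\Delta$ is the free $QV(a)$-algebra on $X$. An algebraizable logic is Lindenbaum algebraizable if $\varphi\dashv\vdash\psi\iff\ \vdash\varphi\Delta\psi$ for all formulas $\varphi,\psi$. $\mathcal A_f$ is the category of algebraizable logics and flexible translations preserving algebraizing pairs, i.e. sending an algebraizing pair $(\tau,\Delta)$ of the source to an algebraizing pair $(\check f(\tau),\check f(\Delta))$ of the target. **Functors on algebras.** For $h:a\to a'$ in $\mathcal A_f$ and a $\Sigma'$-algebra $M$, $h^\star(M)$ is the $\Sigma$-algebra on the same set with $c_n^{h^\star(M)}=h(c_n)^M$, and $h^\star$ is the identity on maps. It restricts to $h^\star{\restriction}:QV(a')\to QV(a)$, which has a left adjoint, written $L_h:QV(a)\to QV(a')$, with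 unit $\bar\partial:Id\Rightarrow h^\star{\restriction}\circ L_h$. One identifies $L_h(F(\Sigma)/\Delta)$ with $F(\Sigma')/\Delta'$, so that the unit at $F(\Sigma)/\Delta$ is $\bar\partial_X:F(\Sigma)/\Delta\to h^\star(F(\Sigma')/\Delta')$, $[\theta]\mapsto[\check h(\theta)]$. **Glivenko's context.** A pair $\mathbb{G}=(h:a\to a',\bar\rho)$ with $h\in\mathcal A_f(a,a')$ and $\bar\rho:h^\star{\restriction}\circ L_h\Rightarrow Id$ a natural transformation (of endofunctors of $QV(a)$) which is a section of the unit: $\bar\partial_M\circ\bar\rho_M=id$ for all $M\in QV(a)$. Write $\bar\rho_X:h^\star(F(\Sigma')/\Delta')\to F(\Sigma)/\Delta$ for its component at $F(\Sigma)/\Delta$. A lifting $\rho_X:F(\Sigma')(X)\to F(\Sigma)(X)$ of $\bar\rho_X$ is any (chosen) function with $[\rho_X(\theta')]=\bar\rho_X([\theta'])$ for all $\theta'\in F(\Sigma')(X)$. *)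

(* Defs.v *)
From mathcomp Require Import all_boot.
From mathcomp Require Import boolp classical_sets functions cardinality.

Set Implicit Arguments.
Unset Strict Implicit.
Unset Printing Implicit Defensive.

Local Open Scope classical_set_scope.

(* The sets Sigma_n are disjoint because an n-ary connective is an element of
   a type indexed by n. *)
Definition signature := nat -> Type.

Inductive formula (S : signature) : Type :=
| Var of nat
| App n of S n & ('I_n -> formula S).
Arguments Var {S} _.
Arguments App {S n} _ _.

Fixpoint occurs (S : signature) (i : nat) (phi : formula S) : Prop :=
  match phi with
  | Var j => j = i
  | App n c v => exists k : 'I_n, occurs i (v k)
  end.

(* F(S)[n] *)
Definition formula_in (S : signature) (n : nat) : Type :=
  {phi : formula S | forall i, occurs i phi <-> (i < n)%N}.

(* Carriers are nonempty, as usual in universal algebra. *)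
Record algebra (S : signature) := Algebra {
  carrier :> Type;
  carrier_inh : exists x : carrier, True;
  op : forall n, S n -> ('I_n -> carrier) -> carrier }.
Arguments op {S} M {n} _ _ : rename.

Record hom (S : signature) (M N : algebra S) := Hom {
  hom_fun :> M -> N;
  homP : forall n (c : S n) (v : 'I_n -> M),
    hom_fun (op M c v) = op N c (fun k => hom_fun (v k)) }.

Lemma hom_id_subproof (S : signature) (M : algebra S) n (c : S n)
    (v : 'I_n -> M) : id (op M c v) = op M c (fun k => id (v k)).
Proof. by []. Qed.

Definition hom_id (S : signature) (M : algebra S) : hom M M :=
  @Hom S M M id (@hom_id_subproof S M).

Lemma hom_comp_subproof (S : signature) (M N P : algebra S) (g : hom N P)
    (f : hom M N) n (c : S n) (v : 'I_n -> M) :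
  g (f (op M c v)) = op P c (fun k => g (f (v k))).
Proof. by rewrite !homP. Qed.

Definition hom_comp (S : signature) (M N P : algebra S) (g : hom N P)
    (f : hom M N) : hom M P :=
  @Hom S M P (fun x => g (f x)) (@hom_comp_subproof S M N P g f).

Lemma formula_inh (S : signature) : exists x : formula S, True.
Proof. by exists (Var 0). Qed.

Definition formula_alg (S : signature) : algebra S :=
  Algebra (formula_inh S) (fun n => @App S n).

Fixpoint eval (S : signature) (M : algebra S) (v : nat -> M) (phi : formula S) :
    M :=
  match phi with
  | Var i => v i
  | App n c w => op M c (fun k => eval v (w k))
  end.

Definition subst (S : signature) (sigma : nat -> formula S) :
    formula S -> formula S := @eval S (formula_alg S) sigma.

(* The valuation x_0 |-> v 0, ..., x_(n-1) |-> v (n-1); its values at the other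
   variables are irrelevant, it is only used with formulas of F(S)[n]. *)
Definition assign (S : signature) (M : algebra S) (n : nat) (v : 'I_n -> M)
    (i : nat) : M :=
  oapp v (projT1 (cid (carrier_inh M))) (insub i).

Record logic := Logic {
  sig :> signature;
  entails : set (formula sig) -> formula sig -> Prop;
  entails_refl : forall (G : set (formula sig)) phi, G phi -> entails G phi;
  entails_mono : forall (G G' : set (formula sig)) phi,
    G `<=` G' -> entails G phi -> entails G' phi;
  entails_cut : forall (G D : set (formula sig)) phi,
    (forall psi, D psi -> entails G psi) -> entails D phi -> entails G phi;
  entails_fin : forall (G : set (formula sig)) phi, entails G phi ->
    exists G0 : set (formula sig),
      [/\ finite_set G0, G0 `<=` G & entails G0 phi];
  entails_subst : forall (sigma : nat -> formula sig) (G : set (formula sig))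
    phi, entails G phi -> entails (subst sigma @` G) (subst sigma phi) }.
Arguments entails : clear implicits.

Definition flex_morph (S S' : signature) := forall n, S n -> formula_in S' n.

Fixpoint ext (S S' : signature) (f : flex_morph S S') (phi : formula S) :
    formula S' :=
  match phi with
  | Var i => Var i
  | App n c v =>
      subst (@assign S' (formula_alg S') n (fun k => ext f (v k)))
        (projT1 (f n c))
  end.

Definition is_translation (a a' : logic) (f : flex_morph a a') : Prop :=
  forall G phi, entails a G phi -> entails a' (ext f @` G) (ext f phi).

Definition equation (S : signature) : Type := (formula S * formula S)%type.

Definition holds (S : signature) (M : algebra S) (v : nat -> M)
    (e : equation S) : Prop := eval v e.1 = eval v e.2.

(* Classes of algebras are predicates [algebra S -> Prop] rather than [set]s
   for universe reasons only. *)
Definition eq_conseq (S : signature) (K : algebra S -> Prop)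
    (E : set (equation S)) (e : equation S) : Prop :=
  forall M, K M -> forall v : nat -> M,
    (forall d, E d -> holds v d) -> holds v e.

Definition eq_conseqs (S : signature) (K : algebra S -> Prop)
    (E E' : set (equation S)) : Prop := forall e, E' e -> eq_conseq K E e.

(* tau(phi); only x_0 occurs in tau. *)
Definition tau_at (S : signature) (tau : set (equation S)) (phi : formula S) :
    set (equation S) :=
  (fun e => (subst (fun=> phi) e.1, subst (fun=> phi) e.2)) @` tau.

(* phi Delta psi; only x_0 (for p) and x_1 (for q) occur in Delta. *)
Definition delta_at (S : signature) (Delta : set (formula S))
    (phi psi : formula S) : set (formula S) :=
  subst (fun i => if i is 0 then phi else psi) @` Delta.

Record algebraizes (a : logic) (K : algebra a -> Prop)
    (tau : set (equation a)) (Delta : set (formula a)) : Prop := Algebraizes {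
  tau_fin : finite_set tau;
  tau_var : forall e i, tau e -> occurs i e.1 \/ occurs i e.2 -> i = 0;
  delta_fin : finite_set Delta;
  delta_var : forall d i, Delta d -> occurs i d -> i = 0 \/ i = 1;
  entails_tau : forall G phi, entails a G phi <->
    eq_conseqs K (\bigcup_(gamma in G) tau_at tau gamma) (tau_at tau phi);
  delta_tau : forall phi psi,
    eq_conseqs K [set (phi, psi)]
      (\bigcup_(d in delta_at Delta phi psi) tau_at tau d) /\
    eq_conseqs K (\bigcup_(d in delta_at Delta phi psi) tau_at tau d)
      [set (phi, psi)] }.

Definition algebraizing_pair (a : logic) (tau : set (equation a))
    (Delta : set (formula a)) : Prop :=
  exists K, algebraizes K tau Delta.

Definition algebraizable (a : logic) : Prop :=
  exists tau Delta, @algebraizing_pair a tau Delta.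

Record alg_logic := AlgLogic {
  alg_logic_val :> logic;
  alg_logicP : algebraizable alg_logic_val }.

Definition is_quasivariety (S : signature) (K : algebra S -> Prop) : Prop :=
  exists Q : set (set (equation S) * equation S),
    (forall q, Q q -> finite_set q.1) /\
    (forall M, K M <-> forall q, Q q -> eq_conseq (fun N => N = M) q.1 q.2).

Definition equivalent_quasivariety (a : logic) (K : algebra a -> Prop) : Prop :=
  is_quasivariety K /\ exists tau Delta, algebraizes K tau Delta.

(* Membership in the quasivariety QV(a); see [equivalent_quasivariety_QV] and
   [equivalent_quasivariety_unique] below. *)
Definition QV (a : logic) (M : algebra a) : Prop :=
  exists K, equivalent_quasivariety K /\ K M.

(* |- phi Delta psi, for an algebraizing pair (tau, Delta); independent of the
   choice of that pair, see [delta_eqE] below. *)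
Definition delta_eq (a : logic) (phi psi : formula a) : Prop :=
  exists tau Delta, algebraizing_pair tau Delta /\
    forall d, delta_at Delta phi psi d -> entails a set0 d.

Definition lindenbaum_algebraizable (a : logic) : Prop :=
  algebraizable a /\
  forall phi psi : formula a,
    (entails a [set phi] psi /\ entails a [set psi] phi) <-> delta_eq phi psi.

Record af_morphism (a a' : alg_logic) := AfMorphism {
  af_fun :> flex_morph a a';
  af_translation : @is_translation a a' af_fun;
  af_pair : forall (tau : set (equation a)) (Delta : set (formula a)),
    algebraizing_pair tau Delta ->
    @algebraizing_pair a'
      ((fun e => (ext af_fun e.1, ext af_fun e.2)) @` tau)
      (ext af_fun @` Delta) }.

(* QV(a) is a full subcategory: its morphisms are all the [hom]s between these
   objects. *)
Record qv_alg (a : logic) := QVAlg {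
  qv_val :> algebra a;
  qvP : QV qv_val }.

Definition reduct (S S' : signature) (f : flex_morph S S') (M : algebra S') :
    algebra S :=
  @Algebra S M (carrier_inh M)
    (fun n c v => eval (@assign S' M n v) (projT1 (f n c))).

Definition delta_class_set (a : logic) (phi : formula a) : formula a -> Prop :=
  fun psi => delta_eq phi psi.

Definition delta_class (a : logic) : Type :=
  {C : formula a -> Prop | exists phi, C = delta_class_set phi}.

Definition class_of (a : logic) (phi : formula a) : delta_class a :=
  exist _ (delta_class_set phi) (ex_intro _ phi erefl).

Definition class_repr (a : logic) (C : delta_class a) : formula a :=
  projT1 (cid (projT2 C)).

Lemma delta_class_inh (a : logic) : exists x : delta_class a, True.
Proof. by exists (class_of (Var 0)). Qed.

(* The operations are defined on representatives; see [class_of_op] below. *)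
Definition lindenbaum_alg (a : logic) : algebra a :=
  @Algebra a (delta_class a) (delta_class_inh a)
    (fun n c v => class_of (App c (fun k => class_repr (v k)))).

Section Evaluation.
Variables (S : signature).

Lemma eval_occurs (M : algebra S) (v w : nat -> M) (phi : formula S) :
  (forall i, occurs i phi -> v i = w i) -> eval v phi = eval w phi.
Proof.
elim: phi => [j|n c u IH] /= vw; first exact: vw.
by congr (op M c _); apply: funext => k; apply: IH => i ik; apply: vw; exists k.
Qed.

Lemma eval_subst (M : algebra S) (v : nat -> M) sigma (phi : formula S) :
  eval v (subst sigma phi) = eval (fun i => eval v (sigma i)) phi.
Proof.
elim: phi => [j|n c u IH] //=.
by congr (op M c _); apply: funext => k; apply: IH.
Qed.

Lemma hom_eval (M N : algebra S) (g : hom M N) (v : nat -> M) phi :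
  g (eval v phi) = eval (fun i => g (v i)) phi.
Proof.
elim: phi => [j|n c u IH] //=; rewrite homP.
by congr (op N c _); apply: funext => k; apply: IH.
Qed.

Lemma assignE (M : algebra S) n (v : 'I_n -> M) (k : 'I_n) : assign v k = v k.
Proof. by rewrite /assign valK. Qed.

Lemma eval_assign (M : algebra S) n (v : 'I_n -> M) (w : nat -> M)
    (phi : formula_in S n) : (forall k : 'I_n, w k = v k) ->
  eval (assign v) (projT1 phi) = eval w (projT1 phi).
Proof.
move=> wv; apply: eval_occurs => i /(projT2 phi) ltin.
by have := assignE v (Ordinal ltin) => /= ->; rewrite -wv.
Qed.

Lemma subst_Var (phi : formula S) : subst Var phi = phi.
Proof.
elim: phi => [j|n c u IH] //=.
by congr (App c _); apply: funext => k; apply: IH.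
Qed.

End Evaluation.

Lemma eval_reduct (S S' : signature) (f : flex_morph S S') (M : algebra S')
    (v : nat -> M) (phi : formula S) :
  @eval S (reduct f M) v phi = eval v (ext f phi).
Proof.
elim: phi => [j|n c u IH] //=.
rewrite eval_subst; apply: eval_assign => k.
by rewrite assignE IH.
Qed.

Lemma ext_subst (S S' : signature) (f : flex_morph S S') sigma
    (phi : formula S) :
  ext f (subst sigma phi) = subst (fun i => ext f (sigma i)) (ext f phi).
Proof.
rewrite -[RHS](@eval_reduct S S' f (formula_alg S')).
elim: phi => [j|n c u IH] //=.
have -> : (fun k => ext f (subst sigma (u k))) =
          (fun k => @eval S (reduct f (formula_alg S')) (fun i => ext f (sigma i))
             (u k)) by apply: funext.
by [].
Qed.

Lemma reduct_hom_subproof (S S' : signature) (f : flex_morph S S')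
    (M N : algebra S') (g : hom M N) n (c : S n) (v : 'I_n -> reduct f M) :
  g (op (reduct f M) c v) = op (reduct f N) c (fun k => g (v k)).
Proof.
rewrite /= hom_eval; symmetry; apply: eval_assign => k.
by rewrite assignE.
Qed.

Definition reduct_hom (S S' : signature) (f : flex_morph S S')
    (M N : algebra S') (g : hom M N) : hom (reduct f M) (reduct f N) :=
  @Hom S (reduct f M) (reduct f N) g (@reduct_hom_subproof S S' f M N g).

Section EquivalentQuasivariety.
Variable a : logic.
Implicit Types (K : algebra a -> Prop) (tau : set (equation a)).
Implicit Types (Delta : set (formula a)) (E : set (equation a)).

Definition deltas Delta E : set (formula a) :=
  \bigcup_(e in E) delta_at Delta e.1 e.2.

Lemma holds_delta K tau Delta (M : algebra a) (v : nat -> M) phi psi :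
  algebraizes K tau Delta -> K M ->
  holds v (phi, psi) <->
  forall d, delta_at Delta phi psi d -> forall e, tau_at tau d e -> holds v e.
Proof.
move=> A KM; have [H1 H2] := delta_tau A phi psi; split=> [h d dD e te|h].
  by apply: (H1 e _ M KM v) => [|_ ->//]; exists d.
by apply: (H2 _ _ M KM v) => // e [d dD te]; apply: h te.
Qed.

Lemma eq_conseqE K tau Delta E phi psi : algebraizes K tau Delta ->
  eq_conseq K E (phi, psi) <->
  forall d, delta_at Delta phi psi d -> entails a (deltas Delta E) d.
Proof.
move=> A; split=> [h d dD|h M KM v hE].
  apply/(entails_tau A) => e te M KM v hv.
  apply: (iffLR (holds_delta v phi psi A KM)) te => //.
  apply: h => // -[s t] Est; apply/(holds_delta v s t A KM) => d' d'D e' te'.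
  by apply: hv; exists d' => //; exists (s, t).
apply/(holds_delta v phi psi A KM) => d dD e te.
have /(entails_tau A)/(_ e te M KM v) := h d dD; apply => e' [d' [[s t] Est d'D]] te'.
by apply: (iffLR (holds_delta v s t A KM)) te'; [exact: hE|].
Qed.

Lemma delta_indep K K1 tau tau1 Delta Delta1 G phi psi :
  algebraizes K tau Delta -> algebraizes K1 tau1 Delta1 ->
  (forall d, delta_at Delta phi psi d -> entails a G d) ->
  forall d, delta_at Delta1 phi psi d -> entails a G d.
Proof.
move=> A A1 h _ [d D1d <-].
have refl1 : entails a set0 (subst (fun i => if i is 0 then phi else phi) d).
  have : forall d, delta_at Delta1 phi phi d -> entails a (deltas Delta1 set0) d.
    by apply/(eq_conseqE _ _ _ A1).
  by rewrite /deltas bigcup_set0; apply; exists d.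
apply/(entails_tau A) => e te M KM v hv.
have hpq : holds v (phi, psi).
  apply/(holds_delta v phi psi A KM) => d' d'D e' te'.
  by have /(entails_tau A)/(_ e' te' M KM v) := h _ d'D; apply.
case: te => -[s t] st <-; rewrite /holds [LHS]eval_subst [RHS]eval_subst.
have -> : eval v (subst (fun i => if i is 0 then phi else psi) d) =
          eval v (subst (fun i => if i is 0 then phi else phi) d).
  rewrite !eval_subst; congr (eval _ d); apply: funext => -[|i] //.
move/(entails_tau A) : refl1.
set r := subst _ d => /(_ (subst (fun=> r) s, subst (fun=> r) t)) refl1.
have : holds v (subst (fun=> r) s, subst (fun=> r) t).
  by apply: refl1 => //; [exists (s, t)|move=> ? []].
by rewrite /holds [LHS]eval_subst [RHS]eval_subst.
Qed.

Lemma eq_conseq_indep K K1 tau tau1 Delta Delta1 E e :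
  algebraizes K tau Delta -> algebraizes K1 tau1 Delta1 ->
  eq_conseq K E e -> eq_conseq K1 E e.
Proof.
case: e => phi psi A A1 /(eq_conseqE _ _ _ A) h.
apply/(eq_conseqE _ _ _ A1) => d dD.
apply: (delta_indep A A1 _ dD) => d' d'D.
apply: entails_cut (h _ d'D) => g [[s t] Est gD].
apply: (delta_indep A1 A _ gD) => g' g'D.
by apply: entails_refl; exists (s, t).
Qed.

Theorem equivalent_quasivariety_unique K K1 :
  equivalent_quasivariety K -> equivalent_quasivariety K1 ->
  forall M, K M <-> K1 M.
Proof.
suff H K2 K3 : equivalent_quasivariety K2 -> equivalent_quasivariety K3 ->
    forall M, K2 M -> K3 M by move=> eK eK1 M; split; apply: H.
move=> [_ [t2 [D2 A2]]] [[Q [_ QP]] [t3 [D3 A3]]] M K2M; apply/QP => q Qq.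
have : eq_conseq K3 q.1 q.2.
  move=> N K3N v; exact: (iffLR (QP N) K3N q Qq N erefl).
by move=> /(eq_conseq_indep A3 A2)/(_ M K2M) h N ->.
Qed.

Definition quasi_hull K (M : algebra a) : Prop :=
  forall E e, finite_set E -> eq_conseq K E e ->
    eq_conseq (fun N => N = M) E e.

Lemma quasi_hull_quasivariety K : is_quasivariety (quasi_hull K).
Proof.
exists [set q | finite_set q.1 /\ eq_conseq K q.1 q.2]; split=> [q []//|M].
split=> [h q [] //|h E e finE KEe]; first exact: h.
exact: (h (E, e)).
Qed.

Lemma sub_quasi_hull K M : K M -> quasi_hull K M.
Proof. by move=> KM E e _ h N ->; apply: h. Qed.

Lemma eq_conseq_finite K tau Delta E e : algebraizes K tau Delta ->
  eq_conseq K E e ->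
  exists E0, [/\ finite_set E0, E0 `<=` E & eq_conseq K E0 e].
Proof.
case: e => phi psi A /(eq_conseqE _ _ _ A) h.
have /choice[F FP] : forall d, exists F, delta_at Delta phi psi d ->
    [/\ finite_set F, F `<=` deltas Delta E & entails a F d].
  move=> d; have [dD|ndD] := pselect (delta_at Delta phi psi d); last by exists set0.
  by have [F FP] := entails_fin (h d dD); exists F.
pose G := \bigcup_(d in delta_at Delta phi psi) F d.
have finG : finite_set G.
  apply: bigcup_finite => [|d /FP[]//]; exact/finite_image/(delta_fin A).
have /choice[c cP] : forall g, exists e, G g -> E e /\ delta_at Delta e.1 e.2 g.
  move=> g; have [[d dD Fg]|nG] := pselect (G g); last by exists (phi, psi).
  by have [_ /(_ g Fg)[e Ee eg] _] := FP d dD; exists e.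
exists (c @` G); split; first exact: finite_image.
  by move=> _ [g Gg <-]; have [] := cP g Gg.
apply/(eq_conseqE _ _ _ A) => d dD; have [_ _ Fd] := FP d dD.
apply: entails_mono Fd => g Fg; have Gg : G g by exists d.
by have [_ cg] := cP g Gg; exists (c g) => //; exists g.
Qed.

Lemma algebraizes_quasi_hull K tau Delta : algebraizes K tau Delta ->
  algebraizes (quasi_hull K) tau Delta.
Proof.
move=> A.
have H E e : eq_conseq K E e <-> eq_conseq (quasi_hull K) E e.
  split=> [/(eq_conseq_finite A)[E0 [finE0 sE0 h]] M QM v hv|h M KM].
    by apply: (QM E0 e finE0 h M erefl) => d /sE0; apply: hv.
  exact/h/sub_quasi_hull.
have Hs E E' : eq_conseqs K E E' <-> eq_conseqs (quasi_hull K) E E'.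
  by split=> h e /h/H.
case: A => *; split=> //; first by move=> G phi; rewrite -Hs.
by move=> phi psi; rewrite -!Hs.
Qed.

Theorem equivalent_quasivariety_QV :
  algebraizable a -> equivalent_quasivariety (@QV a).
Proof.
move=> [tau [Delta [K /algebraizes_quasi_hull A]]].
have eq : equivalent_quasivariety (quasi_hull K).
  by split; [exact: quasi_hull_quasivariety|exists tau, Delta].
have QVE : @QV a = quasi_hull K.
  apply: funext => M; apply/propext; split=> [[K1 [eK1 K1M]]|hM].
    exact/(equivalent_quasivariety_unique eK1 eq).
  by exists (quasi_hull K).
by rewrite QVE.
Qed.

Theorem algebraizes_QV tau Delta :
  algebraizing_pair tau Delta -> algebraizes (@QV a) tau Delta.
Proof.
move=> [K /algebraizes_quasi_hull A].
suff -> : @QV a = quasi_hull K by [].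
have eq : equivalent_quasivariety (quasi_hull K).
  by split; [exact: quasi_hull_quasivariety|exists tau, Delta].
apply: funext => M; apply/propext; split=> [[K1 [eK1 K1M]]|hM].
  exact/(equivalent_quasivariety_unique eK1 eq).
by exists (quasi_hull K).
Qed.

Theorem delta_eqE tau Delta (phi psi : formula a) : algebraizing_pair tau Delta ->
  delta_eq phi psi <->
  forall d, delta_at Delta phi psi d -> entails a set0 d.
Proof.
move=> P; split=> [[tau1 [Delta1 [P1 h]]]|h]; last by exists tau, Delta.
exact: delta_indep (algebraizes_QV P1) (algebraizes_QV P) h.
Qed.

Lemma delta_eq_QV (phi psi : formula a) : algebraizable a ->
  delta_eq phi psi <-> eq_conseq (@QV a) set0 (phi, psi).
Proof.
move=> [tau [Delta P]]; rewrite (delta_eqE _ _ P).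
have := eq_conseqE set0 phi psi (algebraizes_QV P).
by rewrite /deltas bigcup_set0 => ->.
Qed.

Lemma class_ofP (phi psi : formula a) : algebraizable a ->
  class_of phi = class_of psi <-> delta_eq phi psi.
Proof.
move=> ha; have D chi xi := delta_eq_QV chi xi ha; split=> [[]|h].
  move=> /(congr1 (@^~ psi)) E; change (delta_class_set phi psi); rewrite E.
  by apply/D => M _ v _.
apply: eq_exist; apply: funext => chi; apply/propext.
rewrite /delta_class_set !D; have /D hQ := h.
split=> hc M QM v _; rewrite /holds /=.
  by rewrite -(hQ M QM v)//; apply: hc.
by rewrite [LHS](hQ M QM v)//; apply: hc.
Qed.

Lemma class_reprK : cancel (@class_repr a) (@class_of a).
Proof.
move=> C; rewrite /class_repr; case: cid => phi /= e.
by case: C e => C HC /= e; apply: eq_exist.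
Qed.

Theorem class_of_op n (c : sig a n) (u : 'I_n -> formula a) :
  algebraizable a ->
  class_of (App c u) = op (lindenbaum_alg a) c (fun k => class_of (u k)).
Proof.
move=> ha; apply/(class_ofP _ _ ha)/(delta_eq_QV _ _ ha) => M QM v _.
rewrite /holds /=; congr (op M c _); apply: funext => k.
have /(class_ofP _ _ ha)/(delta_eq_QV _ _ ha)/(_ M QM v) := 
  esym (class_reprK (class_of (u k))).
by apply.
Qed.

Lemma eval_class (sigma : nat -> formula a) phi : algebraizable a ->
  @eval _ (lindenbaum_alg a) (fun i => class_of (sigma i)) phi =
  class_of (subst sigma phi).
Proof.
move=> ha; elim: phi => [j|n c u IH] //=.
rewrite [RHS](class_of_op _ _ ha) /=.
by congr (class_of (App c _)); apply: funext => k; rewrite IH.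
Qed.

Theorem QV_lindenbaum_alg : algebraizable a -> QV (lindenbaum_alg a).
Proof.
move=> ha; have eQV := equivalent_quasivariety_QV ha.
have [[Q [finQ QP]] [tau [Delta A]]] := eQV.
apply/QP => q Qq N -> v.
pose sigma i := class_repr (v i).
have -> : v = fun i => class_of (sigma i).
  by apply: funext => i; rewrite class_reprK.
have hE e : holds (M := lindenbaum_alg a) (fun i => class_of (sigma i)) e <->
    eq_conseq (@QV a) set0 (subst sigma e.1, subst sigma e.2).
  by rewrite /holds !(eval_class _ _ ha) (class_ofP _ _ ha) (delta_eq_QV _ _ ha).
move=> hq; apply/hE => M QM w _; rewrite /holds /= !eval_subst.
apply: (iffLR (QP M) QM q Qq M erefl) => d /hq/hE/(_ M QM w).
by rewrite /holds /= !eval_subst; apply.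
Qed.

End EquivalentQuasivariety.

Definition free_qv (a : alg_logic) : qv_alg a :=
  QVAlg (QV_lindenbaum_alg (alg_logicP a)).

Lemma ext_delta_at (S S' : signature) (f : flex_morph S S')
    (Delta : set (formula S)) phi psi :
  delta_at (ext f @` Delta) (ext f phi) (ext f psi) =
  ext f @` delta_at Delta phi psi.
Proof.
have E d : subst (fun i => if i is 0 then ext f phi else ext f psi) (ext f d) =
           ext f (subst (fun i => if i is 0 then phi else psi) d).
  by rewrite ext_subst; congr (subst _ _); apply: funext => -[|i].
apply/seteqP; split=> x [_ [d dD <-] <-].
  rewrite E; exists (subst (fun i => if i is 0 then phi else psi) d) => //.
  by exists d.
by rewrite -E; exists (ext f d) => //; exists d.
Qed.

Theorem QV_reduct (a a' : alg_logic) (h : af_morphism a a')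
    (M : algebra a') : QV M -> QV (reduct h M).
Proof.
move=> QM; have [[Q [finQ QP]] _] := equivalent_quasivariety_QV (alg_logicP a).
have [tau [Delta P]] := alg_logicP a.
have A := algebraizes_QV P; have A' := algebraizes_QV (af_pair h P).
apply/QP => -[E [phi psi]] Qq N -> v /= hE.
have : eq_conseq (@QV a) E (phi, psi).
  by move=> N' QN'; apply: (iffLR (QP N') QN' _ Qq N' erefl).
move=> /(eq_conseqE _ _ _ A) H.
have H' : eq_conseq (@QV a') ((fun e => (ext h e.1, ext h e.2)) @` E)
                 (ext h phi, ext h psi).
  apply/(eq_conseqE _ _ _ A') => d; rewrite ext_delta_at => -[d0 d0D <-].
  apply: entails_mono (af_translation h (H d0 d0D)) => _ [g [[s t] Est gD] <-].
  exists (ext h s, ext h t); first by exists (s, t).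
  by rewrite /= ext_delta_at; exists g.
rewrite /holds /= !eval_reduct; apply: (H' M QM v) => _ [[s t] Est <-].
by have := hE _ Est; rewrite /holds /= !eval_reduct.
Qed.

Definition reduct_qv (a a' : alg_logic) (h : af_morphism a a')
    (M : qv_alg a') : qv_alg a := QVAlg (QV_reduct h (qvP M)).

(* A left adjoint L_h of the restricted reduct functor QV(a') -> QV(a),
   presented by its unit and the universal property of the unit. *)
Record left_adjoint (a a' : alg_logic) (h : af_morphism a a') := LeftAdjoint {
  ladj_obj :> qv_alg a -> qv_alg a';
  ladj_map : forall M N : qv_alg a, hom M N -> hom (ladj_obj M) (ladj_obj N);
  ladj_map_id : forall M : qv_alg a, ladj_map (hom_id M) =1 id;
  ladj_map_comp : forall (M N P : qv_alg a) (g : hom N P) (f : hom M N),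
    ladj_map (hom_comp g f) =1 ladj_map g \o ladj_map f;
  ladj_unit : forall M : qv_alg a, hom M (reduct_qv h (ladj_obj M));
  ladj_unit_nat : forall (M N : qv_alg a) (f : hom M N),
    reduct_hom h (ladj_map f) \o ladj_unit M =1 ladj_unit N \o f;
  ladj_universal : forall (M : qv_alg a) (N : qv_alg a')
      (f : hom M (reduct_qv h N)),
    exists2 g : hom (ladj_obj M) N,
      reduct_hom h g \o ladj_unit M =1 f &
      forall g' : hom (ladj_obj M) N,
        reduct_hom h g' \o ladj_unit M =1 f -> g' =1 g }.

(* The identification of F(S')/Delta' with L_h(F(S)/Delta), under which the unit
   is [theta] |-> [h theta]; see [free_identification_ex] below. *)
Record free_identification (a a' : alg_logic) (h : af_morphism a a')
    (L : left_adjoint h) := FreeIdentification {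
  fid_hom :> hom (free_qv a') (L (free_qv a));
  fid_bij : bijective fid_hom;
  fid_unit : forall theta : formula a,
    fid_hom (class_of (ext h theta)) =
    ladj_unit L (free_qv a) (class_of theta) }.

Definition free_lift_fun (a : alg_logic) (M : qv_alg a) (v : nat -> M)
    (x : free_qv a) : M := eval v (class_repr x).

Lemma free_lift_class (a : alg_logic) (M : qv_alg a) (v : nat -> M) phi :
  free_lift_fun v (class_of phi) = eval v phi.
Proof.
have /(class_ofP _ _ (alg_logicP a))/(delta_eq_QV _ _ (alg_logicP a)) :=
  class_reprK (class_of phi).
by move=> /(_ M (qvP M) v); apply.
Qed.

Lemma free_lift_subproof (a : alg_logic) (M : qv_alg a) (v : nat -> M) n
    (c : sig a n) (w : 'I_n -> free_qv a) :
  free_lift_fun v (op (free_qv a) c w) = op M c (fun k => free_lift_fun v (w k)).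
Proof. exact: free_lift_class. Qed.

Definition free_lift (a : alg_logic) (M : qv_alg a) (v : nat -> M) :
    hom (free_qv a) M :=
  @Hom a (free_qv a) M (free_lift_fun v) (@free_lift_subproof a M v).

Lemma eval_class_Var (a : alg_logic) (phi : formula a) :
  @eval _ (lindenbaum_alg a) (fun i => class_of (Var i)) phi = class_of phi.
Proof. by rewrite (eval_class _ _ (alg_logicP a)) subst_Var. Qed.

Theorem free_identification_ex (a a' : alg_logic) (h : af_morphism a a')
    (L : left_adjoint h) : inhabited (free_identification L).
Proof.
pose u : nat -> L (free_qv a) :=
  fun i => ladj_unit L (free_qv a) (class_of (Var i)).
pose i := free_lift u.
pose f := @free_lift a (reduct_qv h (free_qv a')) (fun i => class_of (Var i)).
have fE theta : f (class_of theta) = class_of (ext h theta).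
  by rewrite [LHS]free_lift_class [LHS]eval_reduct eval_class_Var.
have iE theta : i (class_of (ext h theta)) =
    ladj_unit L (free_qv a) (class_of theta).
  rewrite [LHS]free_lift_class -[LHS]eval_reduct -[in RHS]eval_class_Var.
  by rewrite [RHS]hom_eval.
have [g gE _] := ladj_universal L f.
have [k kE kU] := ladj_universal L (ladj_unit L (free_qv a)).
split; exists i => //; exists g => x.
  rewrite -(class_reprK x) [i _]free_lift_class hom_eval -eval_class_Var.
  by congr (eval _ _); apply: funext => j; rewrite [LHS]gE [LHS]fE.
transitivity (k x); first (apply: (kU (hom_comp i g)) => y).
  rewrite -(class_reprK y) -iE; congr (i _).
  by rewrite [LHS]gE [LHS]fE.
by symmetry; apply: (kU (hom_id _)).
Qed.

Record glivenko_context (a a' : alg_logic) (h : af_morphism a a')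
    (L : left_adjoint h) := GlivenkoContext {
  rho_bar :> forall M : qv_alg a, hom (reduct_qv h (L M)) M;
  rho_bar_nat : forall (M N : qv_alg a) (f : hom M N),
    f \o rho_bar M =1 rho_bar N \o reduct_hom h (ladj_map L f);
  rho_bar_section : forall M : qv_alg a, ladj_unit L M \o rho_bar M =1 id }.

Definition rho_bar_X (a a' : alg_logic) (h : af_morphism a a')
    (L : left_adjoint h) (G : glivenko_context L) (i : free_identification L) :
    lindenbaum_alg a' -> lindenbaum_alg a :=
  fun theta' => G (free_qv a) (i theta').

Definition is_lifting (a a' : alg_logic) (h : af_morphism a a')
    (L : left_adjoint h) (G : glivenko_context L) (i : free_identification L)
    (rho : formula a' -> formula a) : Prop :=
  forall theta' : formula a',
    class_of (rho theta') = rho_bar_X G i (class_of theta').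

(* Main.v *)
Require Import Defs.
From mathcomp Require Import all_boot.
From mathcomp Require Import boolp classical_sets functions cardinality.

Local Open Scope classical_set_scope.

(** Left to right, translate along [h]: the section property at the free algebra
    says that [ext h (rho theta')] and [theta'] have the same class, hence are
    interderivable. Right to left, argue semantically: a valuation [v] in
    [M : QV a] is a morphism [f : F/Delta -> M], and naturality of [rho_bar] at
    [f] shows that [v] evaluates [rho theta'] to the [rho_bar]-image of the value
    of [theta'] in [L M] under [L f]. Since [rho_bar] is an injective morphism,
    [tau (rho theta')] holds in [M] iff [h tau (theta')] holds in [L M], so
    the entailment in [a'], read in [L M], gives the one in [a]. *)

Lemma rho_bar_inj (a a' : alg_logic) (h : af_morphism a a')
    (L : left_adjoint h) (G : glivenko_context L) (M : qv_alg a) :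
  injective (G M).
Proof. exact: (@can_inj _ _ (G M) (ladj_unit L M) (@rho_bar_section _ _ _ _ G M)). Qed.

Section Lifting.
Set Implicit Arguments.
Unset Strict Implicit.
Context {a a' : alg_logic} {h : af_morphism a a'} {L : left_adjoint h}.
Context {G : glivenko_context L} {i : free_identification L}.
Context {rho : formula a' -> formula a} (rhoP : is_lifting G i rho).

(** Through the bijection [i], [ext h] becomes the unit, which undoes [rho_bar]. *)
Lemma class_of_ext_lifting (theta : formula a') :
  class_of (ext h (rho theta)) = class_of theta.
Proof.
apply: (bij_inj (fid_bij i)).
rewrite [LHS]fid_unit rhoP; exact: rho_bar_section.
Qed.

Definition lifted_valuation (M : qv_alg a) (v : nat -> M) (n : nat) : L M :=
  ladj_map L (free_lift v : hom (free_qv a) M) (i (class_of (Var n))).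

Lemma eval_lifting (M : qv_alg a) (v : nat -> M) (theta : formula a') :
  eval v (rho theta) = G M (eval (lifted_valuation v) theta).
Proof.
rewrite -free_lift_class rhoP.
have /= -> := rho_bar_nat G (free_lift v : hom (free_qv a) M) (i (class_of theta)).
(* [class_of theta] is [theta] evaluated at the free generators, so homs commute with it. *)
by rewrite -eval_class_Var !hom_eval.
Qed.

(** [G M] starts from the reduct of [L M], where evaluating [t] means evaluating [ext h t] in
    [L M]. *)
Lemma eval_subst_lifting (M : qv_alg a) (v : nat -> M) (theta : formula a')
    (t : formula a) :
  eval v (subst (fun=> rho theta) t) =
  G M (eval (lifted_valuation v) (subst (fun=> theta) (ext h t))).
Proof.
by rewrite !eval_subst eval_lifting -(eval_reduct h) hom_eval.
Qed.

Lemma holds_tau_lifting (M : qv_alg a) (v : nat -> M) (tau : set (equation a))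
    (theta : formula a') :
  (forall e, tau_at tau (rho theta) e -> holds v e) <->
  (forall e, tau_at ((fun e => (ext h e.1, ext h e.2)) @` tau) theta e ->
     holds (lifted_valuation v) e).
Proof.
split=> [H _ [_ [e te <-] <-]|H _ [e te <-]].
  apply: (@rho_bar_inj _ _ _ _ G M); rewrite -!eval_subst_lifting.
  by apply: (H (_, _)); exists e.
rewrite /holds /= !eval_subst_lifting; congr (G M _).
by apply: (H (_, _)); exists (ext h e.1, ext h e.2) => //; exists e.
Qed.

End Lifting.

Theorem corollary4p13 (a a' : alg_logic)
    (La : lindenbaum_algebraizable a) (La' : lindenbaum_algebraizable a')
    (h : af_morphism a a') (L : left_adjoint h) (G : glivenko_context L)
    (i : free_identification L)
    (rho : formula a' -> formula a) (rhoP : is_lifting G i rho) :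
  forall (Gamma' : set (formula a')) (phi' : formula a'),
    entails a (rho @` Gamma') (rho phi') <-> entails a' Gamma' phi'.
Proof.
move=> Gamma' phi'; split=> [/(af_translation h) H|H].
  have E theta : entails a' [set ext h (rho theta)] theta /\
                 entails a' [set theta] (ext h (rho theta)).
    (* Lindenbaum algebraizability of [a'] turns equal classes into interderivability. *)
    apply/(La'.2); apply/(class_ofP _ _ (alg_logicP a')).
    exact: class_of_ext_lifting rhoP theta.
  have cut1 theta psi : entails a' [set theta] psi -> entails a' Gamma' theta ->
      entails a' Gamma' psi.
    by move=> h1 h2; apply: entails_cut h1 => _ ->.
  apply: (cut1 _ _ (E phi').1); apply: entails_cut H => _ [_ [gamma Ggamma <-] <-].
  by apply: (cut1 _ _ (E gamma).2); apply: entails_refl.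
have [tau [Delta P]] := alg_logicP a.
apply/(entails_tau (algebraizes_QV P)) => e te M QM v hv.
pose N : qv_alg a := QVAlg QM.
move: e te; apply/(holds_tau_lifting rhoP (M := N)) => e te.
have /(entails_tau (algebraizes_QV (af_pair h P))) := H.
move=> /(_ e te (L N) (qvP _)); apply => d [gamma Ggamma].
move: d; apply/(holds_tau_lifting rhoP (M := N)) => d td.
by apply: hv; exists (rho gamma) => //; exists gamma.
Qed.
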